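(* Let $\mathfrak{A}$ be a unital $\mathrm{C}^*$-algebra, let $\mathfrak{S}\subset\mathfrak{A}$ be a self-adjoint subspace and let $\mathfrak{T}\subset\mathfrak{A}$ be a separable operator system. Assume that the pair $(\mathfrak{S},\mathfrak{T})$ is unperforated. Then, for every self-adjoint element $s\in\mathfrak{S}$, there is a state $\psi$ on $\mathfrak{A}$ which restricts to be pure on $\mathfrak{T}$ and such that $|\psi(s)|=\|s\|$. In particular, there is a family of states on $\mathfrak{A}$ which separate $\mathfrak{S}$ and restrict to be pure on $\mathfrak{T}$.
   Context: $\mathrm{C}^*$-algebras are concretely represented on Hilbert space; an operator system in $\mathfrak{A}$ is a self-adjoint subspace containing the unit of $\mathfrak{A}$. The pair $(\mathfrak{S},\mathfrak{T})$ of self-adjoint subspaces of $\mathfrak{A}$ is unperforated if for every pair of self-adjoint elements $a\in\mathfrak{S}$, $b\in\mathfrak{T}$ with $a\le b$, there is a self-adjoint element $b'\in\mathfrak{T}$ such that $\|b'\|\le\|a\|$ and $a\le b'\le b$. A state on an operator system is a unital (completely) positive linear functional. A state $\psi$ on an operator system is pure if whenever $\phi$ is a positive linear functional with $\psi-\phi$ positive, then $\phi=t\psi$ for some $0\le t\le1$; equivalently, $\psi$ is an extreme point of the set of states. A collection $\mathcal{F}$ of states on $\mathfrak{A}$ separates $\mathfrak{S}$ if $\sup_{\psi\in\mathcal{F}}|\psi(s)|>0$ for every non-zero self-adjoint $s\in\mathfrak{S}$. *)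

(* Defs.v *)
From HB Require Import structures.
From mathcomp Require Import all_boot all_order all_algebra.
From mathcomp Require Import complex.
From mathcomp Require Import all_classical all_reals all_analysis.

Set Implicit Arguments.
Unset Strict Implicit.
Unset Printing Implicit Defensive.

Import Order.TTheory GRing.Theory Num.Theory.
Import numFieldNormedType.Exports.

Local Open Scope classical_set_scope.
Local Open Scope ring_scope.

(* C*-algebras are concrete: norm-closed *-subalgebras of B(H), for H a complex
   Hilbert space.  Operators are plain functions [H -> H], added and scaled
   pointwise and multiplied by composition; "H is a Hilbert space" is rendered
   by a complete normed module over [R[i]] whose norm comes from [ip], which is
   linear in its first argument. *)
Definition norm_from_ip (R : realType) (H : completeNormedModType R[i])
    (ip : {dot H for Num.conj}) : Prop :=
  forall x : H, ip x x = `|x| ^+ 2.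

Definition bounded_operator (R : realType) (H : completeNormedModType R[i])
    (f : H -> H) : Prop :=
  linear f /\ continuous f.

(* [`|f x|] is a nonnegative real living in [R[i]]; [complex.Re] reads it in
   [R].  The supremum is only meaningful for bounded operators. *)
Definition opnorm (R : realType) (H : completeNormedModType R[i])
    (f : H -> H) : R :=
  sup [set complex.Re `|f x| | x in [set x : H | `|x| <= 1]].

Definition adjoint_of (R : realType) (H : completeNormedModType R[i])
    (ip : {dot H for Num.conj}) (f g : H -> H) : Prop :=
  forall x y : H, ip (f x) y = ip x (g y).

Definition self_adjoint (R : realType) (H : completeNormedModType R[i])
    (ip : {dot H for Num.conj}) (f : H -> H) : Prop :=
  adjoint_of ip f f.

(* In [R[i]], [0 <= z] means that z is real and nonnegative. *)
Definition op_ge0 (R : realType) (H : completeNormedModType R[i])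
    (ip : {dot H for Num.conj}) (f : H -> H) : Prop :=
  forall x : H, 0 <= ip (f x) x.

Definition op_le (R : realType) (H : completeNormedModType R[i])
    (ip : {dot H for Num.conj}) (f g : H -> H) : Prop :=
  op_ge0 ip (g - f).

Definition subspace (R : realType) (H : completeNormedModType R[i])
    (V : set (H -> H)) : Prop :=
  V 0 /\ forall (c : R[i]) (f g : H -> H), V f -> V g -> V (c *: f + g).

Definition self_adjoint_subspace (R : realType)
    (H : completeNormedModType R[i]) (ip : {dot H for Num.conj})
    (V : set (H -> H)) : Prop :=
  subspace V /\ forall f, V f -> exists2 g, V g & adjoint_of ip f g.

(* The unit [e] is not required to be the identity of H (it is then a proper
   projection), but it must be nonzero. *)
Record unital_cstar_algebra (R : realType) (H : completeNormedModType R[i])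
    (ip : {dot H for Num.conj}) (A : set (H -> H)) (e : H -> H) : Prop := {
  cstar_bounded : forall f, A f -> bounded_operator f;
  cstar_subspace : self_adjoint_subspace ip A;
  cstar_mul : forall f g, A f -> A g -> A (f \o g);
  cstar_closed : forall f, bounded_operator f ->
    (forall eps : R, 0 < eps -> exists2 g, A g & opnorm (f - g) < eps) -> A f;
  cstar_unit : A e;
  cstar_mul1 : forall f, A f -> e \o f = f /\ f \o e = f;
  cstar_unit_neq0 : e <> 0 }.

Definition operator_system (R : realType) (H : completeNormedModType R[i])
    (ip : {dot H for Num.conj}) (A : set (H -> H)) (e : H -> H)
    (T : set (H -> H)) : Prop :=
  [/\ T `<=` A, self_adjoint_subspace ip T & T e].

Definition norm_separable (R : realType) (H : completeNormedModType R[i])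
    (V : set (H -> H)) : Prop :=
  exists D : set (H -> H), [/\ countable D, D `<=` V &
    forall f, V f -> forall eps : R, 0 < eps ->
      exists2 d, D d & opnorm (f - d) < eps].

Definition unperforated (R : realType) (H : completeNormedModType R[i])
    (ip : {dot H for Num.conj}) (S T : set (H -> H)) : Prop :=
  forall a b : H -> H, S a -> self_adjoint ip a -> T b -> self_adjoint ip b ->
    op_le ip a b ->
    exists b' : H -> H, [/\ T b', self_adjoint ip b', opnorm b' <= opnorm a,
      op_le ip a b' & op_le ip b' b].

(* A functional on a subspace V is a total function of which only the values
   on V matter, so restricting it to a smaller subspace does not change the
   function. *)
Definition positive_functional (R : realType)
    (H : completeNormedModType R[i]) (ip : {dot H for Num.conj})
    (V : set (H -> H)) (phi : (H -> H) -> R[i]) : Prop :=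
  (forall (c : R[i]) (f g : H -> H), V f -> V g ->
     phi (c *: f + g) = c * phi f + phi g) /\
  (forall f, V f -> op_ge0 ip f -> 0 <= phi f).

Definition state (R : realType) (H : completeNormedModType R[i])
    (ip : {dot H for Num.conj}) (e : H -> H) (V : set (H -> H))
    (psi : (H -> H) -> R[i]) : Prop :=
  positive_functional ip V psi /\ psi e = 1.

Definition pure_state (R : realType) (H : completeNormedModType R[i])
    (ip : {dot H for Num.conj}) (e : H -> H) (V : set (H -> H))
    (psi : (H -> H) -> R[i]) : Prop :=
  state ip e V psi /\
  forall phi : (H -> H) -> R[i], positive_functional ip V phi ->
    positive_functional ip V (fun f => psi f - phi f) ->
    exists2 t : R, 0 <= t <= 1 & forall f, V f -> phi f = t%:C%C * psi f.

Definition separates (R : realType) (H : completeNormedModType R[i])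
    (ip : {dot H for Num.conj}) (F : set ((H -> H) -> R[i]))
    (S : set (H -> H)) : Prop :=
  forall s : H -> H, S s -> self_adjoint ip s -> s <> 0 ->
    (0 < ereal_sup [set (complex.Re `|psi s|)%:E | psi in F])%E.

(* Main.v *)
Require Import Defs.
From HB Require Import structures.
From mathcomp Require Import all_boot all_order all_algebra.
From mathcomp Require Import complex.
From mathcomp Require Import all_classical all_reals all_analysis.
From mathcomp Require Import lra ring.
Import Order.TTheory GRing.Theory Num.Theory.
Import numFieldNormedType.Exports.
Local Open Scope classical_set_scope.
Local Open Scope ring_scope.
(** Let [n] be the norm of [s].  The numerical range of one of [s] and [- s]
    comes arbitrarily close to [n] ([attains_norm_or]), and since the claim is
    symmetric in the two, let it be that of [s].  The states [psi] of [A] with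
    [psi s = n] then form a nonempty face of the state space of [A].  The point
    is that, because [(S, T)] is unperforated, the restrictions of these states
    to [T] form a face of the state space of [T].  Indeed, a state [omega] of
    [T] is such a restriction exactly when [n <= omega b] for all [b] in [T]
    with [s <= b].  Any such [b] dominates some [b'] in [T] with [s <= b'] and
    [b' <= n e]; so if [psi s = n] and [psi] is split on [T] into positive
    functionals [phi1 + phi2], then [psi b' = n], each [phi_i b' <= n * phi_i e]
    is forced to be an equality, and [n * phi1 e <= phi1 b] ([gauge_facial]).
    An extreme point of this face of the state space of [T] is pure on [T], and
    it extends to a state of [A] with value [n] at [s].

    The extreme point and its extension are produced together, by one use of
    Zorn's lemma and without any weak-* topology.  A weak-* closed convex set of
    states is recorded by its support function, a sublinear functional on the
    self-adjoint part of [A]; the face above has support function [gauge].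
    Cutting a set down to the states that maximise [d] is the operation
    [tighten], explicit on support functions.  A support function is [facial]
    when the set behind it restricts to a face over [T].  A minimal facial
    minorant of [gauge] is stable under [tighten], first along [d] in [T], and,
    being then linear on [T], along every [d]; hence it is linear
    ([extreme_minorant]).  Facial and linear is pure on [T].

    All of this happens over the reals.  A real linear functional on the
    self-adjoint elements extends to a complex one by the Cartesian
    decomposition [f = re_op f + i im_op f] ([complexify]). *)
Set Implicit Arguments.
Unset Strict Implicit.
Unset Printing Implicit Defensive.

(** * Sublinear functionals on a real subspace *)

Section Sublinear.
Variables (R : realType) (V : lmodType R).
Implicit Types (A : set V) (p f : V -> R).

Definition real_subspace A :=
  A 0 /\ forall (a : R) x y, A x -> A y -> A (a *: x + y).

Definition linear_on A f :=
  forall (a : R) x y, A x -> A y -> f (a *: x + y) = a * f x + f y.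

Definition sublinear_on A p :=
  (forall x y, A x -> A y -> p (x + y) <= p x + p y) /\
  (forall (a : R) x, 0 < a -> A x -> p (a *: x) <= a * p x).

Section Subspace.
Variable A : set V.
Hypothesis hA : real_subspace A.

Lemma real_subspace0 : A 0. Proof. by case: hA. Qed.

Lemma real_subspaceZ a x : A x -> A (a *: x).
Proof. by case: hA => A0 AL Ax; rewrite -[_ *: _]addr0; exact: AL. Qed.

Lemma real_subspaceD x y : A x -> A y -> A (x + y).
Proof. by case: hA => A0 AL Ax Ay; rewrite -[x]scale1r; exact: AL. Qed.

Lemma real_subspaceN x : A x -> A (- x).
Proof. by move=> Ax; rewrite -scaleN1r; exact: real_subspaceZ. Qed.

Lemma real_subspaceB x y : A x -> A y -> A (x - y).
Proof. by move=> Ax Ay; apply: real_subspaceD => //; exact: real_subspaceN. Qed.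

Lemma linear_onD f x y : linear_on A f -> A x -> A y -> f (x + y) = f x + f y.
Proof. by move=> fL Ax Ay; rewrite -[x]scale1r fL// mul1r scale1r. Qed.

Lemma linear_on0 f : linear_on A f -> f 0 = 0.
Proof.
move=> fL; have := linear_onD fL real_subspace0 real_subspace0.
by rewrite addr0; lra.
Qed.

Lemma linear_onZ f a x : linear_on A f -> A x -> f (a *: x) = a * f x.
Proof.
move=> fL Ax; rewrite -[a *: x]addr0 fL ?(linear_on0 fL) ?addr0//.
exact: real_subspace0.
Qed.

Lemma linear_onN f x : linear_on A f -> A x -> f (- x) = - f x.
Proof. by move=> fL Ax; rewrite -scaleN1r linear_onZ// mulN1r. Qed.

Lemma linear_onB f x y : linear_on A f -> A x -> A y -> f (x - y) = f x - f y.
Proof.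
by move=> fL Ax Ay; rewrite linear_onD// ?linear_onN//; exact: real_subspaceN.
Qed.

Lemma sublinear_on0 p : sublinear_on A p -> p 0 = 0.
Proof.
case=> pD pZ; have A0 := real_subspace0.
have := pD 0 0 A0 A0; rewrite addr0 => p0_ge0.
have := pZ 2^-1 0 _ A0; rewrite scaler0 => /(_ ltac:(lra)); lra.
Qed.

Lemma sublinear_onZ p a x : sublinear_on A p -> 0 <= a -> A x ->
  p (a *: x) = a * p x.
Proof.
move=> pS; rewrite le_eqVlt => /predU1P[<-|a0] Ax.
  by rewrite scale0r mul0r sublinear_on0.
have [_ pZ] := pS; apply/eqP; rewrite eq_le pZ//= -ler_pdivlMl//.
rewrite -{1}(scalerK (lt0r_neq0 a0) x).
by apply: pZ; [rewrite invr_gt0|exact: real_subspaceZ].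
Qed.

Lemma sublinear_on_ge p x : sublinear_on A p -> A x -> - p (- x) <= p x.
Proof.
move=> pS Ax; have := pS.1 _ _ Ax (real_subspaceN Ax).
by rewrite subrr sublinear_on0//; lra.
Qed.

(** [p (x + y)] is bounded above by subadditivity, and below by subadditivity
    applied to [x = (x + y) + - y] once [p (- y) = - p y]. *)
Lemma odd_sublinear_linear p : sublinear_on A p ->
  (forall x, A x -> p (- x) <= - p x) -> linear_on A p.
Proof.
move=> pS podd.
have pN x : A x -> p (- x) = - p x.
  by move=> Ax; apply/eqP; rewrite eq_le podd//= lerNl sublinear_on_ge.
have pD x y : A x -> A y -> p (x + y) = p x + p y.
  move=> Ax Ay; apply/eqP; rewrite eq_le pS.1//=.
  have Axy := real_subspaceD Ax Ay.
  have := pS.1 _ _ Axy (real_subspaceN Ay).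
  by rewrite addrK pN// lerBrDr.
move=> a x y Ax Ay; rewrite pD//; last exact: real_subspaceZ.
congr (_ + _); have [a0|a0] := leP 0 a; first exact: sublinear_onZ.
rewrite -[LHS]opprK -pN; last exact: real_subspaceZ.
by rewrite -scaleNr sublinear_onZ// ?mulNr ?opprK// oppr_ge0 ltW.
Qed.

(** Every sublinear functional of the proof is an infimum of this shape: the
    gauge of an order, the limit of a chain, and the result of [tighten]. *)
Lemma sublinear_inf (C : V -> set R) :
    (forall x, A x -> has_inf (C x)) ->
    (forall x y a b, A x -> A y -> C x a -> C y b ->
      exists2 c, C (x + y) c & c <= a + b) ->
    (forall (t : R) x a, 0 < t -> A x -> C x a -> C (t *: x) (t * a)) ->
  sublinear_on A (fun x => inf (C x)).
Proof.
move=> Cinf CD CZ; split => [x y Ax Ay|t x t0 Ax].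
  rewrite -lerBlDr; apply: lb_le_inf; first by case: (Cinf x Ax).
  move=> a Ca; rewrite lerBlDr -lerBlDl.
  apply: lb_le_inf; first by case: (Cinf y Ay).
  move=> b Cb; rewrite lerBlDl.
  have [c Cc cab] := CD _ _ _ _ Ax Ay Ca Cb; apply: le_trans cab.
  by apply: ge_inf => //; case: (Cinf _ (real_subspaceD Ax Ay)).
rewrite -ler_pdivrMl//; apply: lb_le_inf; first by case: (Cinf x Ax).
move=> a Ca; rewrite ler_pdivrMl//; apply: ge_inf; last exact: CZ.
by case: (Cinf _ (real_subspaceZ t Ax)).
Qed.

End Subspace.

Lemma le_mul_inf (C : set R) (k v : R) : 0 <= k -> C !=set0 ->
  (forall c, C c -> v <= k * c) -> v <= k * inf C.
Proof.
move=> k0 C0 vC; move: k0; rewrite le_eqVlt => /predU1P[k0|k0].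
  by case: C0 => c /vC; rewrite -k0 !mul0r.
rewrite -ler_pdivrMl//; apply: lb_le_inf => // c /vC.
by rewrite ler_pdivrMl.
Qed.

End Sublinear.

(** * Faces and extreme points through support functions *)

Section Faces.
Variables (R : realType) (V : lmodType R) (A T : set V) (e : V).
Variable D : set (V -> R).
Hypotheses (hA : real_subspace A) (hT : real_subspace T) (sTA : T `<=` A).
Hypothesis Te : T e.
Hypothesis D_linear : forall phi, D phi -> linear_on T phi.
Hypothesis D_ge0 : forall phi, D phi -> 0 <= phi e.
Implicit Types (p psi phi : V -> R).

(** [p] is read as the support function of the set of all linear [psi <= p].  To
    say that the restrictions of these [psi] to [T] form a face, one would ask
    [phi1 / phi1 e <= p] on [T] for every summand [phi1] of such a [psi]; the
    normalisation is cleared so that [phi1 e = 0] needs no separate case. *)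
Definition facial p := forall psi, linear_on A psi ->
  (forall x, A x -> psi x <= p x) ->
  forall phi1 phi2, D phi1 -> D phi2 ->
  (forall x, T x -> psi x = phi1 x + phi2 x) ->
  forall x, T x -> phi1 x <= phi1 e * p x.

(** Forces [psi e = 1] for every linear [psi <= p]. *)
Definition unital p := p e <= 1 /\ p (- e) <= - 1.

(** The support function of the face of those [psi <= p] with [psi d = p d]. *)
Definition tighten p d x := inf [set p (x + t *: d) - t * p d | t in [set t | 0 <= t]].

Section Tighten.
Variables (p : V -> R) (d : V).
Hypotheses (pS : sublinear_on A p) (Ad : A d).

Let tighten_has_inf x : A x ->
  has_inf [set p (x + t *: d) - t * p d | t in [set t | 0 <= t]].
Proof.
move=> Ax; split; first by exists (p (x + 0 *: d) - 0 * p d), 0 => /=.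
exists (- p (- x)) => _ [t /= t0 <-].
have Atd := real_subspaceZ hA t Ad; have Axt := real_subspaceD hA Ax Atd.
have := pS.1 _ _ Axt (real_subspaceN hA Ax).
by rewrite addrAC subrr add0r (sublinear_onZ hA)//; lra.
Qed.

Lemma tighten_le t x : 0 <= t -> A x -> tighten p d x <= p (x + t *: d) - t * p d.
Proof.
move=> t0 Ax; apply: ge_inf; last by exists t.
by case: (tighten_has_inf Ax).
Qed.

Lemma tighten_le_self x : A x -> tighten p d x <= p x.
Proof. by move=> Ax; have := tighten_le (lexx 0) Ax; rewrite scale0r mul0r addr0 subr0. Qed.

Lemma tighten_opp : tighten p d (- d) <= - p d.
Proof.
have := tighten_le ler01 (real_subspaceN hA Ad).
by rewrite scale1r addNr (sublinear_on0 hA pS) mul1r add0r.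
Qed.

Lemma tighten_sublinear : sublinear_on A (tighten p d).
Proof.
apply: (sublinear_inf hA) => [x Ax|x y _ _ Ax Ay [t /= t0 <-] [u /= u0 <-]|].
- exact: tighten_has_inf.
- exists (p (x + y + (t + u) *: d) - (t + u) * p d).
    by exists (t + u) => //=; exact: addr_ge0.
  have -> : x + y + (t + u) *: d = (x + t *: d) + (y + u *: d).
    by rewrite scalerDl addrACA.
  have := pS.1 (x + t *: d) (y + u *: d).
  move/(_ (real_subspaceD hA Ax (real_subspaceZ hA t Ad))).
  move/(_ (real_subspaceD hA Ay (real_subspaceZ hA u Ad))).
  lra.
- move=> t x _ t0 Ax [u /= u0 <-]; exists (t * u) => /=.
    by rewrite mulr_ge0// ltW.
  rewrite -scalerA -scalerDr (sublinear_onZ hA pS (ltW t0)).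
    by rewrite -mulrA -mulrBr.
  by apply: (real_subspaceD hA) => //; exact: real_subspaceZ.
Qed.

(** If [psi] attains [p d] and splits as [phi1 + phi2] on [T], then the two bounds
    [phi_i d <= phi_i e * p d] add up to an equality, so both are equalities:
    the summands attain the maximum as well. *)
Lemma tighten_facial_in : unital p -> facial p -> T d -> facial (tighten p d).
Proof.
move=> [pe pNe] pF Td psi psiL psip phi1 phi2 D1 D2 psiE x Tx.
have psip' y : A y -> psi y <= p y.
  by move=> Ay; apply: le_trans (psip y Ay) _; exact: tighten_le_self.
have F1 := pF _ psiL psip' _ _ D1 D2 psiE.
have F2 : forall x, T x -> phi2 x <= phi2 e * p x.
  by apply: (pF _ psiL psip' _ _ D2 D1) => y Ty; rewrite addrC psiE.
have psid : psi d = p d.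
  apply/eqP; rewrite eq_le psip'//= -lerN2 -(linear_onN hA psiL)//.
  by apply: le_trans tighten_opp; apply: psip; exact: real_subspaceN.
have psie : psi e = 1.
  have Ae := sTA Te; apply/eqP; rewrite eq_le (le_trans (psip' _ Ae) pe)/=.
  rewrite -lerN2 -(linear_onN hA psiL)//.
  by apply: le_trans pNe; apply: psip'; exact: real_subspaceN.
have phi1d : phi1 e * p d <= phi1 d.
  have := F2 _ Td; have := psiE _ Td; have := psiE _ Te.
  rewrite psid psie => E1 E2; have -> : phi2 e = 1 - phi1 e by lra.
  by rewrite mulrBl mul1r; lra.
rewrite /tighten; apply: le_mul_inf; [exact: D_ge0| |].
  by exists (p (x + 0 *: d) - 0 * p d), 0 => /=.
move=> _ [t /= t0 <-].
have Ttd := real_subspaceZ hT t Td.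
have := F1 _ (real_subspaceD hT Tx Ttd).
rewrite (linear_onD (D_linear D1))// (linear_onZ hT t (D_linear D1))//.
rewrite mulrBr; have := ler_wpM2l t0 phi1d; lra.
Qed.

(** Where [p] is odd, every [psi <= p] agrees with [p], so cutting down along a
    further [d] cannot change [p] on [T]. *)
Lemma tighten_facial_odd : (forall x, T x -> p (- x) <= - p x) ->
  facial p -> facial (tighten p d).
Proof.
move=> podd pF psi psiL psip phi1 phi2 D1 D2 psiE x Tx.
have psip' y : A y -> psi y <= p y.
  by move=> Ay; apply: le_trans (psip y Ay) _; exact: tighten_le_self.
apply: le_trans (pF _ psiL psip' _ _ D1 D2 psiE x Tx) _.
apply: ler_wpM2l; first exact: D_ge0.
(* [p x <= tighten p d x]: compare [p (t *: d)] with [p (x + t *: d) + p (- x)]. *)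
rewrite /tighten; apply: lb_le_inf; first by exists (p (x + 0 *: d) - 0 * p d), 0 => /=.
move=> _ [t /= t0 <-]; have Ax := sTA Tx; have Atd := real_subspaceZ hA t Ad.
have := pS.1 _ _ (real_subspaceD hA Ax Atd) (real_subspaceN hA Ax).
rewrite addrAC subrr add0r (sublinear_onZ hA)//.
by have := podd _ Tx; lra.
Qed.

End Tighten.

Variable p0 : V -> R.
Hypotheses (p0S : sublinear_on A p0) (p0u : unital p0) (p0F : facial p0).

Record facial_minorant p : Prop := FacialMinorant {
  facial_minorantS : sublinear_on A p;
  facial_minorantF : facial p;
  facial_minorant_le : forall x, A x -> p x <= p0 x }.

Lemma facial_minorant_unital p : facial_minorant p -> unital p.
Proof.
case=> _ _ pp0; case: p0u => p0e p0Ne; have Ae := sTA Te; split.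
  exact: le_trans (pp0 _ Ae) p0e.
by apply: le_trans p0Ne; apply: pp0; exact: (real_subspaceN hA Ae).
Qed.

Let descends p q := `[< forall x, A x -> q x <= p x >].

(** The intersection of a chain of faces is a face; sublinearity of the infimum
    is where the chain condition enters.  That the infimum is finite comes from
    the common bound [- p0 (- x) <= p x]. *)
Lemma facial_chain_bound (C : set (V -> R)) :
  C `<=` facial_minorant -> C !=set0 -> total_on C descends ->
  exists2 q, facial_minorant q & forall p, C p -> descends p q.
Proof.
move=> CF [p1 Cp1] Ctot; pose q x := inf [set p x | p in C].
have qinf x : A x -> has_inf [set p x | p in C].
  move=> Ax; split; first by exists (p1 x), p1.
  exists (- p0 (- x)) => _ [p Cp <-]; have [pS _ pp0] := CF _ Cp.
  apply: le_trans (sublinear_on_ge hA pS Ax); rewrite lerN2.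
  by apply: pp0; exact: (real_subspaceN hA Ax).
have qle p : C p -> forall x, A x -> q x <= p x.
  by move=> Cp x Ax; apply: ge_inf; [case: (qinf x Ax)|exists p].
exists q; last by move=> p Cp; apply/asboolP; exact: qle.
split.
- apply: (sublinear_inf hA) => //.
    move=> x y _ _ Ax Ay [p Cp <-] [p' Cp' <-].
    have Axy := real_subspaceD hA Ax Ay.
    have [/asboolP pp'|/asboolP p'p] := Ctot _ _ Cp Cp'.
      exists (p' (x + y)); first by exists p'.
      have [pS _ _] := CF _ Cp'; apply: le_trans (pS.1 _ _ Ax Ay) _.
      by rewrite lerD2r pp'.
    exists (p (x + y)); first by exists p.
    have [pS _ _] := CF _ Cp; apply: le_trans (pS.1 _ _ Ax Ay) _.
    by rewrite lerD2l p'p.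
  move=> t x _ t0 Ax [p Cp <-]; exists p => //.
  by have [pS _ _] := CF _ Cp; rewrite (sublinear_onZ hA pS (ltW t0)).
- move=> psi psiL psiq phi1 phi2 D1 D2 psiE x Tx.
  apply: le_mul_inf; [exact: D_ge0|by exists (p1 x), p1|].
  move=> _ [p Cp <-]; have [_ pF _] := CF _ Cp.
  apply: (pF psi psiL _ _ _ D1 D2 psiE) => // y Ay.
  exact: le_trans (psiq _ Ay) (qle _ Cp _ Ay).
- by move=> x Ax; apply: le_trans (qle _ Cp1 _ Ax) _; exact: (facial_minorant_le (CF _ Cp1) Ax).
Qed.

Lemma minimal_facial_minorant : exists2 p, facial_minorant p &
  forall q, facial_minorant q -> (forall x, A x -> q x <= p x) ->
    forall x, A x -> p x <= q x.
Proof.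
pose M := {p | facial_minorant p}.
have m0 : facial_minorant p0 by split.
pose le_M (p q : M) := descends (sval p) (sval q).
have [|||[p pM] pmin] := @ZL_preorder M (exist _ p0 m0) le_M.
- by move=> p; apply/asboolP.
- move=> q p r /asboolP pq /asboolP qr; apply/asboolP => x Ax.
  exact: le_trans (qr x Ax) (pq x Ax).
- move=> C Ctot; have [C0|/set0P[c Cc]] := eqVneq C set0.
    by exists (exist _ p0 m0) => s; rewrite C0.
  have [|||q qM Cq] := @facial_chain_bound [set sval c | c in C].
  + by move=> _ [c' _ <-]; exact: svalP.
  + by exists (sval c), c.
  + by move=> _ _ [a Ca <-] [b Cb <-]; exact: Ctot.
  + by exists (exist _ q qM) => a Ca; apply: Cq; exists a.
- exists p => // q qM qp; have /asboolP := pmin (exist _ q qM) (asboolT qp).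
  exact.
Qed.

(** A minimal facial minorant is odd along [d] as soon as tightening along [d]
    keeps it facial.  This holds for [d] in [T], where tightening selects a
    subface; oddness on [T] then makes it hold for every [d]. *)
Theorem extreme_minorant : exists psi, [/\ linear_on A psi,
  (forall x, A x -> psi x <= p0 x) &
  forall phi1 phi2, D phi1 -> D phi2 ->
    (forall x, T x -> psi x = phi1 x + phi2 x) ->
    forall x, T x -> phi1 x = phi1 e * psi x].
Proof.
have [p pM pmin] := minimal_facial_minorant; have [pS pF pp0] := pM.
have tight d : A d -> facial (tighten p d) -> p (- d) <= - p d.
  move=> Ad tF; apply: le_trans (tighten_opp pS Ad).
  apply: pmin; last exact: real_subspaceN.
  - split=> //; first exact: tighten_sublinear.
    move=> x Ax; apply: le_trans (pp0 _ Ax); exact: tighten_le_self.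
  - by move=> x Ax; exact: tighten_le_self.
have podd d : T d -> p (- d) <= - p d.
  move=> Td; apply: tight; first exact: sTA.
  by apply: tighten_facial_in => //; [exact: sTA|exact: facial_minorant_unital].
have pL : linear_on A p.
  apply: odd_sublinear_linear => // d Ad; apply: tight => //.
  exact: tighten_facial_odd.
exists p; split=> // phi1 phi2 D1 D2 psiE.
have F := pF _ pL (fun _ _ => lexx _) _ _ D1 D2 psiE.
move=> x Tx; apply/eqP; rewrite eq_le F//=.
have := F _ (real_subspaceN hT Tx).
rewrite (linear_onN hT (D_linear D1))// (linear_onN hA pL); last exact: sTA.
by rewrite mulrN lerN2.
Qed.

End Faces.

(** * Restriction of scalars *)

(** Self-adjoint operators are only a real vector space; the alias gives the
    real scalars their own module structure beside the complex one. *)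
Definition realification (R : realType) (E : lmodType R[i]) : Type := E.
Section Realification.
Variables (R : realType) (E : lmodType R[i]).
HB.instance Definition _ := GRing.Zmodule.on (realification E).
Definition real_scale (a : R) (x : realification E) : realification E :=
  (a%:C)%C *: (x : E).

Lemma real_scaleA a b x : real_scale a (real_scale b x) = real_scale (a * b) x.
Proof. by rewrite /real_scale scalerA -rmorphM. Qed.
Lemma real_scale1 : left_id 1 real_scale.
Proof. by move=> x; rewrite /real_scale scale1r. Qed.
Lemma real_scaleDr : right_distributive real_scale +%R.
Proof. by move=> a x y; rewrite /real_scale scalerDr. Qed.
Lemma real_scaleDl x : {morph real_scale^~ x : a b / a + b}.
Proof. by move=> a b; rewrite /real_scale rmorphD scalerDl. Qed.
HB.instance Definition _ := GRing.Zmodule_isLmodule.Build R (realification E)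
  real_scaleA real_scale1 real_scaleDr real_scaleDl.
End Realification.

(** * Quadratic forms of operators *)

Section HilbertOperators.
Variables (R : realType) (H : completeNormedModType R[i]).
Variables (ip : {dot H for Num.conj}).
Hypothesis hip : norm_from_ip ip.
Local Notation Re := complex.Re.
Local Notation Im := complex.Im.
Implicit Types (f g : H -> H) (x y u : H).

Definition rip x y : R := Re (ip x y).

Lemma ipC x y : ip x y = conjc (ip y x).
Proof. by rewrite hermC expr0 mul1r. Qed.

Lemma ripC x y : rip x y = rip y x.
Proof. by rewrite /rip ipC; case: (ip y x). Qed.

Lemma ripDl x y z : rip (x + y) z = rip x z + rip y z.
Proof. by rewrite /rip linearDl raddfD. Qed.

Lemma ripDr x y z : rip z (x + y) = rip z x + rip z y.
Proof. by rewrite ripC ripDl !(ripC z). Qed.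

Lemma ripNl x y : rip (- x) y = - rip x y.
Proof. by rewrite /rip linearNl raddfN. Qed.

Lemma ripNr x y : rip y (- x) = - rip y x.
Proof. by rewrite ripC ripNl ripC. Qed.

Lemma ReM_real (a : R) (z : R[i]) : Re (a%:C%C * z) = a * Re z.
Proof. by case: z => b c /=; rewrite mul0r subr0. Qed.

Lemma ImM_real (a : R) (z : R[i]) : Im (a%:C%C * z) = a * Im z.
Proof. by case: z => b c /=; rewrite mul0r addr0. Qed.

Lemma ripZl (a : R) x y : rip (a%:C%C *: x) y = a * rip x y.
Proof. by rewrite /rip linearZl_LR ReM_real. Qed.

Lemma ripZr (a : R) x y : rip y (a%:C%C *: x) = a * rip y x.
Proof. by rewrite ripC ripZl ripC. Qed.

Definition rnorm x : R := Re `|x|.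

Lemma rnormE x : `|x| = (rnorm x)%:C%C.
Proof. by rewrite /rnorm RRe_real// ger0_real. Qed.

Lemma rnorm_ge0 x : 0 <= rnorm x.
Proof. by rewrite -ler0c -rnormE. Qed.

Lemma rip_rnorm x : rip x x = rnorm x ^+ 2.
Proof. by rewrite /rip hip rnormE -rmorphXn. Qed.

Lemma rip_ge0 x : 0 <= rip x x.
Proof. by rewrite rip_rnorm sqr_ge0. Qed.

Lemma rip_eq0 x : rip x x = 0 -> x = 0.
Proof.
rewrite rip_rnorm => /eqP; rewrite sqrf_eq0 => /eqP x0.
by apply/eqP; rewrite -normr_eq0 rnormE x0.
Qed.

Lemma rnormZ (a : R) x : 0 <= a -> rnorm (a%:C%C *: x) = a * rnorm x.
Proof.
by move=> a0; rewrite /rnorm normrZ ger0_norm ?ler0c// ReM_real.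
Qed.

Lemma linear_fun0 f : linear f -> f 0 = 0.
Proof.
move=> fL; have := fL 1 0 0; rewrite !scale1r addr0 => /eqP.
by rewrite -subr_eq0 opprD addrA subrr sub0r oppr_eq0 => /eqP.
Qed.

Lemma linear_funZ f (a : R[i]) x : linear f -> f (a *: x) = a *: f x.
Proof. by move=> fL; have := fL a x 0; rewrite !addr0 (linear_fun0 fL) addr0. Qed.

Lemma linear_funD f x y : linear f -> f (x + y) = f x + f y.
Proof. by move=> fL; have := fL 1 x y; rewrite !scale1r. Qed.

Lemma linear_funN f x : linear f -> f (- x) = - f x.
Proof. by move=> fL; rewrite -scaleN1r linear_funZ// scaleN1r. Qed.

Lemma opnorm_has_ubound f : bounded_operator f ->
  has_ubound [set Re `|f x| | x in [set x : H | `|x| <= 1]].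
Proof.
move=> [fL fC]; pose F : {linear H -> H} := HB.pack f
  (GRing.isLinear.Build _ _ _ _ f fL).
have [r r0 fr] : exists2 r, 0 < r & forall x, `|F x| <= r * `|x|.
  apply: pinfty_ex_gt0; apply/linear_boundedP.
  exact/linear_bounded_continuous.
have rE : r = (Re r)%:C%C by rewrite RRe_real// gtr0_real.
exists (Re r) => _ [y /= y1 <-]; rewrite -lecR -rE -/(rnorm (f y)) -rnormE.
by apply: le_trans (fr y) _; rewrite ler_piMr// ltW.
Qed.

Lemma opnorm_ge0 f : bounded_operator f -> 0 <= opnorm f.
Proof.
move=> fB; apply: le_trans (rnorm_ge0 (f 0)) _.
apply: ub_le_sup; first exact: opnorm_has_ubound.
by exists 0 => //=; rewrite normr0.
Qed.

Lemma rnorm_opnorm f x : bounded_operator f ->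
  rnorm (f x) <= opnorm f * rnorm x.
Proof.
move=> fB; have [fL _] := fB; have [->|x0] := eqVneq x 0.
  by rewrite linear_fun0// /rnorm !normr0 mulr0.
have nx0 : 0 < rnorm x by rewrite -ltcR -rnormE normr_gt0.
rewrite -ler_pdivrMr// mulrC -rnormZ ?invr_ge0 ?rnorm_ge0//.
rewrite -linear_funZ//; apply: ub_le_sup; first exact: opnorm_has_ubound.
exists ((rnorm x)^-1%:C%C *: x) => //=.
by rewrite rnormE rnormZ ?invr_ge0 ?rnorm_ge0// mulVf// gt_eqF.
Qed.

Lemma opnorm_le f (m : R) : 0 <= m ->
  (forall x, rnorm (f x) <= m * rnorm x) -> opnorm f <= m.
Proof.
move=> m0 fm; apply: sup_le_ub.
  by exists (rnorm (f 0)), 0 => //=; rewrite normr0.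
move=> _ [x /= x1 <-]; apply: le_trans (fm x) _.
by rewrite ler_piMr// -lecR -rnormE.
Qed.

Definition qform f x : R := rip (f x) x.

(** With [n] the norm of [f], expand [0 <= |f x - n x|^2] and use
    [|f x| <= n |x|]; this avoids a general Cauchy-Schwarz inequality. *)
Lemma qform_opnorm f x : bounded_operator f ->
  qform f x <= opnorm f * rip x x.
Proof.
move=> fB; have := rnorm_opnorm x fB; set n := opnorm f => fn.
have n0 : 0 <= n := opnorm_ge0 fB.
have f2 : rip (f x) (f x) <= n ^+ 2 * rip x x.
  by rewrite !rip_rnorm -exprMn lerXn2r// ?nnegrE ?mulr_ge0 ?rnorm_ge0.
have [n00|nn0] := eqVneq n 0.
  have fx0 : f x = 0.
    apply/rip_eq0/eqP; rewrite eq_le rip_ge0 andbT.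
    by move: f2; rewrite n00 expr0n mul0r.
  by rewrite /qform fx0 n00 mul0r /rip linear0l.
have n_gt0 : 0 < n by rewrite lt_neqAle eq_sym nn0.
have := rip_ge0 (f x - n%:C%C *: x).
rewrite ripDl !ripDr !ripNl !ripNr !ripZl !ripZr (ripC x (f x)) -/(qform f x).
move=> H0; rewrite -(ler_pM2l n_gt0); nra.
Qed.

Lemma self_adjoint_ip f x : self_adjoint ip f -> ip (f x) x = (qform f x)%:C%C.
Proof.
move=> fS; rewrite /qform /rip; have : ip (f x) x = conjc (ip (f x) x).
  by rewrite -ipC fS.
by case: (ip (f x) x) => a b [] b0; congr (_ +i* _)%C; lra.
Qed.

Lemma self_adjoint_rip f x y : self_adjoint ip f -> rip (f x) y = rip x (f y).
Proof. by move=> fS; rewrite /rip fS. Qed.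

Lemma op_ge0P f : self_adjoint ip f -> op_ge0 ip f <-> forall x, 0 <= qform f x.
Proof.
move=> fS; split=> f0 x; have := f0 x; first by rewrite self_adjoint_ip// ler0c.
by rewrite -ler0c -self_adjoint_ip.
Qed.

Lemma qformD f g x : qform (f + g) x = qform f x + qform g x.
Proof. exact: ripDl. Qed.

Lemma qformN f x : qform (- f) x = - qform f x.
Proof. exact: ripNl. Qed.

Lemma qformZ (a : R) f x : qform (a%:C%C *: f) x = a * qform f x.
Proof. exact: ripZl. Qed.

Lemma op_leP f g : self_adjoint ip f -> self_adjoint ip g ->
  op_le ip f g <-> forall x, qform f x <= qform g x.
Proof.
move=> fS gS; have gfS : self_adjoint ip (g - f).
  by move=> x y; rewrite linearBl linearBr/= fS gS.
split=> [/(op_ge0P gfS) fg x|fg]; last apply/(op_ge0P gfS) => x.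
  by have := fg x; rewrite qformD qformN; lra.
by have := fg x; rewrite qformD qformN; lra.
Qed.

Lemma adjoint_ofC f g : adjoint_of ip f g -> adjoint_of ip g f.
Proof. by move=> fg x y; rewrite ipC -fg -ipC. Qed.

Lemma adjoint_of_unique f g h : adjoint_of ip f g -> adjoint_of ip f h -> g = h.
Proof.
move=> fg fh; apply/funext => y; apply/subr0_eq/rip_eq0.
by rewrite /rip linearBr/= -fg -fh subrr.
Qed.

Lemma adjoint_of_lin c f f' g g' : adjoint_of ip f f' -> adjoint_of ip g g' ->
  adjoint_of ip (c *: f + g) (conjc c *: f' + g').
Proof.
move=> ff gg x y; rewrite linearPl linearPr /= ff gg.
by congr (_ * _ + _); rewrite -[LHS]conjcK.
Qed.

(** Complex polarisation: comparing [y] and [i y] in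
    [ip (h x) y + ip (h y) x = 0] separates the two terms. *)
Lemma qform0_eq0 h : linear h -> (forall x, ip (h x) x = 0) -> h = 0.
Proof.
move=> hL h0.
have hD x y : ip (h x) y + ip (h y) x = 0.
  have := h0 (x + y); rewrite linear_funD// linearDl !linearDr/= !h0.
  by rewrite add0r addr0.
apply/funext => x; apply/rip_eq0; rewrite /rip /=.
have E1 := hD x (h x); have := hD x ('i%C *: h x).
rewrite linear_funZ// linearZr_LR linearZl_LR/=.
set a := ip (h x) (h x) in E1 *; have -> : ip (h (h x)) x = - a.
  by apply/eqP; rewrite -addr_eq0 addrC E1.
case: a {E1} => b c /= /eqP; rewrite eq_complex/= => /andP[/eqP + /eqP].
by rewrite !(mul0r, mul1r, mulN1r, mulr0); lra.
Qed.

(** A positive operator has a real quadratic form, so it has the same quadratic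
    form as its adjoint. *)
Lemma op_ge0_self_adjoint f g : linear f -> linear g ->
  adjoint_of ip f g -> op_ge0 ip f -> self_adjoint ip f.
Proof.
move=> fL gL fg f0; suff fgE : g = f by move: fg; rewrite fgE.
apply/subr0_eq/qform0_eq0.
  move=> a x y; change (g (a *: x + y) - f (a *: x + y) =
    a *: (g x - f x) + (g y - f y)).
  by rewrite fL gL scalerBr opprD addrACA.
move=> x; rewrite linearBl/=; apply/eqP; rewrite subr_eq0; apply/eqP.
rewrite ipC -fg; have := ger0_Im (f0 x).
by case: (ip (f x) x) => b c /= ->; rewrite oppr0.
Qed.

(** The norm of a self-adjoint operator is its numerical radius.  The difference
    of the quadratic form at [x + t s x] and [x - t s x] is [4 t |s x|^2], while
    the parallelogram law bounds it by [2 m (|x|^2 + t^2 |s x|^2)]. *)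
Lemma self_adjoint_norm_le s (m : R) : linear s -> self_adjoint ip s -> 0 <= m ->
  (forall x, `|qform s x| <= m * rip x x) ->
  forall x, rnorm (s x) <= m * rnorm x.
Proof.
move=> sL sS m0 sm x; rewrite -(@ler_pXn2r _ 2)// ?nnegrE ?mulr_ge0 ?rnorm_ge0//.
rewrite exprMn -!rip_rnorm; set a := rip (s x) (s x); set b := rip x x.
have E t : 4 * t * a <= m * (2 * b + 2 * t ^+ 2 * a).
  have := sm (x + t%:C%C *: s x); have := sm (x - t%:C%C *: s x).
  rewrite /qform !(linear_funD _ _ sL) !(linear_funN _ sL) !(linear_funZ _ _ sL).
  rewrite !ripDl !ripDr !ripNl !ripNr !ripZl !ripZr.
  rewrite (self_adjoint_rip (s x) x)// -(ripC (s x) x) -/a -/b.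
  rewrite !ler_norml => /andP[H1 H2] /andP[H3 H4].
  lra.
(* The bound is optimal at [t = m^-1]. *)
have [m00|mn0] := eqVneq m 0.
  by have := E 1; rewrite m00 expr0n !mul0r; lra.
have m_gt0 : 0 < m by rewrite lt_neqAle eq_sym mn0.
have := ler_wpM2l m0 (E m^-1).
have -> : m * (4 * m^-1 * a) = 4 * a by field.
have -> : m * (m * (2 * b + 2 * m^-1 ^+ 2 * a)) = 2 * m ^+ 2 * b + 2 * a by field.
lra.
Qed.

End HilbertOperators.

(** * Self-adjoint part and Cartesian decomposition *)

Section SelfAdjointPart.
Variables (R : realType) (H : completeNormedModType R[i]).
Variables (ip : {dot H for Num.conj}).
Hypothesis hip : norm_from_ip ip.
Local Notation Re := complex.Re.
Local Notation Im := complex.Im.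

Definition sa_part (W : set (H -> H)) : set (realification (H -> H)) :=
  [set f | W f /\ self_adjoint ip f].

Definition adj (f : H -> H) : H -> H := xget 0 [set g | adjoint_of ip f g].

Definition re_op (f : H -> H) : H -> H := 2^-1 *: (f + adj f).

Definition im_op (f : H -> H) : H -> H := - 'i%C *: (2^-1 *: (f - adj f)).

Lemma half_add (f : H -> H) : (2^-1 : R[i]) *: (f + f) = f :> (H -> H).
Proof.
have -> : f + f = (2%:R : R[i]) *: f by rewrite scaler_nat mulr2n.
by rewrite scalerA mulVf ?scale1r// pnatr_eq0.
Qed.

Lemma i_NiK (f : H -> H) : 'i%C *: (- 'i%C *: f) = f :> (H -> H).
Proof. by rewrite scalerA mulrN -expr2 sqr_i opprK scale1r. Qed.

Lemma Ni_iK (f : H -> H) : - 'i%C *: ('i%C *: f) = f :> (H -> H).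
Proof. by rewrite scalerA mulNr -expr2 sqr_i opprK scale1r. Qed.

Lemma adjE f g : adjoint_of ip f g -> adj f = g.
Proof.
move=> fg; rewrite /adj; case: xgetP => [h _ fh|/(_ g)//].
exact: (adjoint_of_unique hip fh fg).
Qed.

Lemma re_im_opK f : f = re_op f + 'i%C *: im_op f.
Proof. by rewrite /re_op /im_op i_NiK -scalerDr addrACA subrr addr0 half_add. Qed.

(** Uniqueness of the Cartesian decomposition yields the real and imaginary
    parts of a combination without computing its adjoint. *)
Lemma re_im_op_unique (f g : H -> H) : self_adjoint ip f -> self_adjoint ip g ->
  re_op (f + 'i%C *: g) = f /\ im_op (f + 'i%C *: g) = g.
Proof.
move=> fS gS; have fgE : adj (f + 'i%C *: g) = f - 'i%C *: g.
  have := adjoint_of_lin 'i%C gS fS; rewrite addrC => /adjE ->.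
  rewrite addrC; congr (_ + _).
  by rewrite -scaleNr; congr (_ *: _); rewrite /=; congr (_ +i* _)%C; rewrite oppr0.
rewrite /re_op /im_op fgE; split; first by rewrite addrACA subrr addr0 half_add.
by rewrite opprB addrC addrA subrK half_add Ni_iK.
Qed.

Variable W : set (H -> H).
Hypothesis hW : self_adjoint_subspace ip W.

Lemma sa_part_subspace : real_subspace (sa_part W).
Proof.
have [[W0 WL] _] := hW; split.
  by split=> // x y; rewrite /= linear0l linear0r.
move=> a f g [Wf fS] [Wg gS]; split; first exact: WL.
have := adjoint_of_lin a%:C%C fS gS.
by rewrite conjc_real.
Qed.

Lemma adjP f : W f -> W (adj f) /\ adjoint_of ip f (adj f).
Proof. by case: hW => _ WA Wf; have [g Wg fg] := WA _ Wf; rewrite (adjE fg). Qed.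

Lemma subspaceZ c f : W f -> W (c *: f).
Proof.
by have [[W0 WL] _] := hW; move=> Wf; rewrite -[_ *: _]addr0; exact: WL.
Qed.

Lemma re_op_sa f : W f -> sa_part W (re_op f).
Proof.
move=> Wf; have [Wa fa] := adjP Wf; have [[W0 WL] _] := hW; split.
  by apply: subspaceZ; have := WL 1 _ _ Wf Wa; rewrite scale1r.
move=> x y; have E z : re_op f z = 2^-1 *: (f z + adj f z) by [].
rewrite !E linearZl_LR linearZr_LR (linearDl ip) (linearDr ip) /= fa (adjoint_ofC fa).
by rewrite /= fmorphV rmorph_nat addrC.
Qed.

Lemma im_op_sa f : W f -> sa_part W (im_op f).
Proof.
move=> Wf; have [Wa fa] := adjP Wf; have [[W0 WL] _] := hW; split.
  apply: subspaceZ; apply: subspaceZ.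
  by rewrite addrC; have := WL (-1) _ _ Wa Wf; rewrite scaleN1r.
move=> x y; have E z : im_op f z = - 'i%C *: (2^-1 *: (f z - adj f z)) by [].
rewrite !E !linearZl_LR !linearZr_LR (linearBl ip) (linearBr ip) /= fa (adjoint_ofC fa).
rewrite /= fmorphV rmorph_nat -[Num.conj _]/(conjc _) -[_ *: _]/(_ * _).
have -> : (conjc (- 'i) = 'i :> R[i])%C.
  by apply/eqP; rewrite eq_complex /= oppr0 opprK !eqxx.
ring.
Qed.

Definition complexify (psi : realification (H -> H) -> R) (f : H -> H) : R[i] :=
  (psi (re_op f) +i* psi (im_op f))%C.

Lemma re_im_op_lin (c : R[i]) f g : W f -> W g ->
  re_op (c *: f + g) = ((Re c)%:C%C *: re_op f - (Im c)%:C%C *: im_op f) + re_op g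
  /\ im_op (c *: f + g) = ((Re c)%:C%C *: im_op f + (Im c)%:C%C *: re_op f) + im_op g.
Proof.
move=> Wf Wg; have hS := sa_part_subspace.
have rf := re_op_sa Wf; have mf := im_op_sa Wf.
have rg := re_op_sa Wg; have mg := im_op_sa Wg.
set F := (X in re_op _ = X /\ _); set G := (X in _ /\ im_op _ = X).
have FS : sa_part W F.
  apply: (real_subspaceD hS) => //; apply: (real_subspaceB hS).
    exact: (real_subspaceZ hS (Re c) rf).
  exact: (real_subspaceZ hS (Im c) mf).
have GS : sa_part W G.
  apply: (real_subspaceD hS) => //; apply: (real_subspaceD hS).
    exact: (real_subspaceZ hS (Re c) mf).
  exact: (real_subspaceZ hS (Im c) rf).
suff -> : c *: f + g = F + 'i%C *: G by apply: re_im_op_unique; [case: FS|case: GS].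
rewrite [in LHS](re_im_opK f) [in LHS](re_im_opK g) /F /G.
move: (re_op f) (im_op f) (re_op g) (im_op g) => r m r' m'.
rewrite [in LHS](complexE c) !scalerDr !scalerDl !scalerA.
have -> : 'i%C * (Im c)%:C%C * 'i%C = - (Im c)%:C%C :> R[i].
  by rewrite mulrAC -expr2 sqr_i mulN1r.
rewrite scaleNr [(Re c)%:C%C * _]mulrC.
by rewrite (AC ((2*2)*2)%AC (((1*4)*5)*((3*2)*6))%AC).
Qed.

Lemma complexify_linear psi : linear_on (sa_part W) psi ->
  forall (c : R[i]) f g, W f -> W g ->
  complexify psi (c *: f + g) = c * complexify psi f + complexify psi g.
Proof.
move=> psiL c f g Wf Wg; have hS := sa_part_subspace.
have [rE mE] := re_im_op_lin c Wf Wg; rewrite /complexify rE mE.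
have rf := re_op_sa Wf; have mf := im_op_sa Wf.
have rg := re_op_sa Wg; have mg := im_op_sa Wg.
have Z a h : sa_part W h -> sa_part W (a%:C%C *: h).
  exact: (@real_subspaceZ _ _ _ hS a h).
have psiZ a h : sa_part W h -> psi (a%:C%C *: h) = a * psi h.
  exact: (@linear_onZ _ _ _ hS psi a h psiL).
rewrite (linear_onD psiL (real_subspaceB hS (Z _ _ rf) (Z _ _ mf)) rg).
rewrite (linear_onB hS psiL (Z _ _ rf) (Z _ _ mf)).
rewrite (linear_onD psiL (real_subspaceD hS (Z _ _ mf) (Z _ _ rf)) mg).
rewrite (linear_onD psiL (Z _ _ mf) (Z _ _ rf)) !psiZ//.
by case: c {rE mE}.
Qed.

Lemma complexify_sa psi f : linear_on (sa_part W) psi ->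
  sa_part W f -> complexify psi f = (psi f)%:C%C.
Proof.
move=> psiL [Wf fS]; have W0 := sa_part_subspace.1.
have := @re_im_op_unique f 0 fS W0.2; rewrite scaler0 addr0.
by case=> rE iE; rewrite /complexify rE iE (linear_on0 sa_part_subspace psiL).
Qed.

End SelfAdjointPart.

(** * Numerical range in a unital algebra of operators *)

Section UnitalAlgebra.
Variables (R : realType) (H : completeNormedModType R[i]).
Variables (ip : {dot H for Num.conj}).
Hypothesis hip : norm_from_ip ip.
Variables (A : set (H -> H)) (e : H -> H).
Hypothesis hA : unital_cstar_algebra ip A e.
Local Notation Re := complex.Re.
Local Notation Im := complex.Im.
Local Notation q := (qform ip).
Local Notation Asa := (sa_part ip A).

Lemma unit_mull f x : A f -> e (f x) = f x.
Proof. by move=> Af; have [ef _] := cstar_mul1 hA Af; rewrite -[RHS]/(f x) -{2}ef. Qed.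

Lemma unit_mulr f x : A f -> f (e x) = f x.
Proof. by move=> Af; have [_ fe] := cstar_mul1 hA Af; rewrite -{2}fe. Qed.

(** The unit need not be the identity of [H], so this has to be derived: if [g]
    is the adjoint of [e], then [e \o g = g], whence
    [ip (e x) y = ip (g x) (g y)], which is symmetric. *)
Lemma unit_self_adjoint : self_adjoint ip e.
Proof.
have Ae := cstar_unit hA; have [g Ag eg] := (cstar_subspace hA).2 _ Ae.
have eE x y : ip (e x) y = ip (g x) (g y).
  by rewrite eg (adjoint_ofC eg) unit_mull.
by move=> x y; rewrite eE ipC -eE -ipC.
Qed.

Lemma unit_in_sa : Asa e.
Proof. by split; [exact: cstar_unit hA|exact: unit_self_adjoint]. Qed.

Lemma qform_unit x : q e x = rip ip (e x) (e x).
Proof.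
rewrite /qform -{1}(unit_mull x (cstar_unit hA)).
by rewrite (self_adjoint_rip _ _ unit_self_adjoint).
Qed.

Lemma qform_unit_ge0 x : 0 <= q e x.
Proof. by rewrite qform_unit rip_ge0. Qed.

Lemma qform_unit_le x : q e x <= rip ip x x.
Proof.
have := rip_ge0 hip (x - e x).
rewrite ripDl !ripDr !ripNl !ripNr -qform_unit (ripC _ x) -/(qform ip e x).
lra.
Qed.

(** [f <= |f| e] in the order of operators; [f] is compressed to the range of
    [e] before its norm is used. *)
Lemma qform_le_opnorm f x : Asa f -> q f x <= opnorm f * q e x.
Proof.
move=> [Af fS]; have -> : q f x = q f (e x).
  rewrite /qform (unit_mulr _ Af) -{1}(unit_mull x Af).
  by rewrite (self_adjoint_rip _ _ unit_self_adjoint).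
by rewrite qform_unit; apply: qform_opnorm => //; exact: cstar_bounded hA _ Af.
Qed.

(** Says that the largest spectral value of [s] is its norm, in terms of vectors
    of the range of [e], left unnormalised. *)
Definition attains_norm (s : H -> H) := forall eps : R, 0 < eps ->
  exists u, 0 < q e u /\ (opnorm s - eps) * q e u < q s u.

Lemma opnormN (s : H -> H) : opnorm (- s) = opnorm s.
Proof.
by rewrite /opnorm; congr sup; apply/eq_imagel => x _ /=; rewrite normrN.
Qed.

Lemma not_attains_norm s : ~ attains_norm s ->
  exists2 eps : R, 0 < eps & forall u, q s u <= (opnorm s - eps) * q e u \/ q e u <= 0.
Proof.
move=> /existsNP[eps /not_implyP[eps0 Neps]]; exists eps => // u.
have [eu|eu] := ltP 0 (q e u); [left|by right].
by rewrite leNgt; apply/negP => su; apply: Neps; exists u.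
Qed.

(** Otherwise the quadratic form of [s] stays below [|s| - eps] in absolute value
    on the range of [e], and so does the norm of [s]. *)
Lemma attains_norm_or s : Asa s -> attains_norm s \/ attains_norm (- s).
Proof.
move=> [As sS]; apply: contrapT => /not_orP[].
move=> /not_attains_norm[eps1 e1 H1] /not_attains_norm[eps2 e2 H2].
have sB := cstar_bounded hA As.
rewrite opnormN in H2; set n := opnorm s in H1 H2.
pose eps := Num.min eps1 eps2; have eps0 : 0 < eps by rewrite lt_min e1.
have [ep1 ep2] : eps <= eps1 /\ eps <= eps2 by rewrite !ge_min !lexx orbT.
have seu u : q e u <= 0 -> s u = 0.
  move=> eu; rewrite -(unit_mulr u As).
  have -> : e u = 0.
    by apply/(rip_eq0 hip)/eqP; rewrite -qform_unit eq_le eu qform_unit_ge0.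
  by apply: linear_fun0; case: sB.
have Hs u : `|q s u| <= (n - eps) * q e u.
  have [eu|eu] := leP (q e u) 0.
    have eu0 : q e u = 0 by apply/eqP; rewrite eq_le eu qform_unit_ge0.
    by rewrite eu0 mulr0 /qform (seu _ eu) /rip linear0l normr0.
  have [H1u|] := H1 u; last by lra.
  have [H2u|] := H2 u; last by lra.
  rewrite qformN in H2u; rewrite ler_norml.
  have E1 := ler_wpM2r (ltW eu) ep1; have E2 := ler_wpM2r (ltW eu) ep2.
  by apply/andP; split; lra.
have [u eu] : exists u, 0 < q e u.
  apply: contrapT => /forallNP Ne; apply: (cstar_unit_neq0 hA).
  apply/funext => u; apply/(rip_eq0 hip)/eqP; rewrite -qform_unit.
  by rewrite eq_le qform_unit_ge0 andbT leNgt; apply/negP/Ne.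
have neps : 0 <= n - eps.
  by rewrite -(pmulr_lge0 _ eu) (le_trans _ (Hs u)).
have : n <= n - eps.
  apply: opnorm_le => //; apply: (self_adjoint_norm_le hip) => //; first by case: sB.
  move=> x; apply: le_trans (Hs x) _; apply: ler_wpM2l => //.
  exact: qform_unit_le.
lra.
Qed.

Lemma qform_realZ (a : R) (f : realification (H -> H)) x :
  q (a *: f) x = a * q f x.
Proof. exact: qformZ. Qed.

(** * The face of states norming a given element *)

Section NormingStates.
Variables (S T : set (H -> H)) (s : H -> H).
Hypotheses (hT : operator_system ip A e T) (hST : unperforated ip S T).
Hypotheses (Ss : S s) (hs : Asa s) (s_attains : attains_norm s).
Local Notation Tsa := (sa_part ip T).
Local Notation n := (opnorm s).

Let Asub : real_subspace Asa := sa_part_subspace (cstar_subspace hA).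

Let Tsub : real_subspace Tsa.
Proof. by case: hT => _ hT' _; exact: sa_part_subspace. Qed.

Let sTA : Tsa `<=` Asa.
Proof. by case: hT => TA _ _ f [Tf fS]; split=> //; exact: TA. Qed.

Let Tsae : Tsa e.
Proof. by case: hT => _ _ Te; split=> //; exact: unit_self_adjoint. Qed.

(** [c] dominates [x] when [x <= c e + l (n e - s)] for some [l >= 0].  A state
    with [psi s = n] vanishes on [n e - s], so it satisfies [psi x <= c];
    [gauge] is the support function of the set of these states. *)
Definition dominating (x : realification (H -> H)) : set R := [set c |
  exists2 l, 0 <= l &
    forall u, q x u <= c * q e u + l * (n * q e u - q s u)].

Definition gauge x := inf (dominating x).

(** Where [attains_norm s] is used: if [c < 0], the inequality fails on vectors
    whose quadratic form comes within [- c / (l + 1)] of the norm.  It says that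
    the face described by [gauge] is nonempty. *)
Lemma dominating_unit0 c : 
  (exists2 l, 0 <= l & forall u, 0 <= c * q e u + l * (n * q e u - q s u)) -> 
  0 <= c.
Proof.
move=> [l l0 cl]; rewrite leNgt; apply/negP => c0.
have [|u [eu su]] := @s_attains (- c / (l + 1)).
  by apply: divr_gt0; lra.
have := cl u; apply/negP; rewrite -ltNge.
have E : l * (- c / (l + 1)) < - c.
  by rewrite mulrA ltr_pdivrMr ?(mulrC l); lra.
have := ler_wpM2l l0 (ltW su); have := E.
rewrite -(ltr_pM2r eu) => E'; rewrite mulrBl mulrBr mulrA in E' *; nra.
Qed.

Lemma dominating_has_inf x : Asa x -> has_inf (dominating x).
Proof.
move=> Ax; split.
  exists (opnorm x), 0 => // u; rewrite mul0r addr0.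
  exact: qform_le_opnorm.
exists (- opnorm (- x : H -> H)) => c [l l0 cl].
rewrite -subr_ge0; apply: dominating_unit0; exists l => // u.
have := qform_le_opnorm u (real_subspaceN Asub Ax).
by have := cl u; rewrite qformN; lra.
Qed.

Lemma gauge_le x c : Asa x -> dominating x c -> gauge x <= c.
Proof. by move=> Ax; apply: ge_inf; case: (dominating_has_inf Ax). Qed.

Lemma gauge_sublinear : sublinear_on Asa gauge.
Proof.
apply: (sublinear_inf Asub) => [|x y a b Ax Ay [l l0 al] [m m0 bm]|t x a t0 Ax [l l0 al]].
- exact: dominating_has_inf.
- exists (a + b) => //; exists (l + m); first exact: addr_ge0.
  by move=> u; rewrite qformD; have := al u; have := bm u; lra.
- exists (t * l); first by rewrite mulr_ge0// ltW.
  move=> u; rewrite qform_realZ -!mulrA -mulrDr.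
  by rewrite ler_pM2l.
Qed.

Lemma gauge_unital : unital (e : realification (H -> H)) gauge.
Proof.
split; apply: gauge_le.
- exact: sTA.
- by exists 0 => // u; lra.
- exact/(real_subspaceN Asub)/sTA.
- by exists 0 => // u; rewrite qformN; lra.
Qed.

Section BelowGauge.
Variable psi : realification (H -> H) -> R.
Hypotheses (psiL : linear_on Asa psi).
Hypothesis psi_le : forall x, Asa x -> psi x <= gauge x.

Lemma below_gauge_ge0 f : Asa f -> (forall u, 0 <= q f u) -> 0 <= psi f.
Proof.
move=> Af f0; have ANf := real_subspaceN Asub Af.
rewrite -oppr_le0 -(linear_onN Asub psiL)//; apply: le_trans (psi_le ANf) _.
apply: gauge_le => //; exists 0 => // u.
by rewrite qformN; have := f0 u; lra.
Qed.

Lemma below_gauge_unit : psi e = 1.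
Proof.
have [e1 Ne1] := gauge_unital; have Ae := sTA Tsae.
apply/eqP; rewrite eq_le (le_trans (psi_le Ae))//=.
rewrite -lerN2 -(linear_onN Asub psiL)//; apply: le_trans Ne1.
by apply: psi_le; exact: (real_subspaceN Asub).
Qed.

Lemma below_gauge_norming : psi s = n.
Proof.
have ANs := real_subspaceN Asub hs.
apply/eqP; rewrite eq_le; apply/andP; split.
  apply: le_trans (psi_le hs) _; apply: gauge_le => //; exists 0 => // u.
  by rewrite mul0r addr0; exact: qform_le_opnorm.
rewrite -lerN2 -(linear_onN Asub psiL)//; apply: le_trans (psi_le ANs) _.
by apply: gauge_le => //; exists 1 => // u; rewrite qformN; lra.
Qed.

End BelowGauge.

Definition positive_linear : set (realification (H -> H) -> R) :=
  [set phi | linear_on Tsa phi /\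
    forall f, Tsa f -> (forall u, 0 <= q f u) -> 0 <= phi f].

(** The use of unperforation.  From [x <= c e + l (n e - s)] with [l > 0], the
    element [b = n e + l^-1 (c e - x)] of [T] dominates [s].  Replacing it by
    [b' <= n e] between [s] and [b] gives [n <= psi b'], hence
    [n * phi1 e <= phi1 b' <= phi1 b], which unfolds to [phi1 x <= c * phi1 e]. *)
Lemma gauge_facial : facial Asa Tsa (e : realification (H -> H)) positive_linear gauge.
Proof.
move=> psi psiL psi_le phi1 phi2 [L1 P1] [L2 P2] psiE x Tx.
have psie := below_gauge_unit psiL psi_le.
have psis := below_gauge_norming psiL psi_le.
have Dge phi (L : linear_on Tsa phi) (P : forall f, Tsa f -> (forall u, 0 <= q f u) -> 0 <= phi f)
    f g : Tsa f -> Tsa g -> (forall u, q f u <= q g u) -> phi f <= phi g.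
  move=> Tf Tg fg; rewrite -subr_ge0 -(linear_onB Tsub)//; apply: P.
    exact: (real_subspaceB Tsub).
  by move=> u; rewrite qformD qformN subr_ge0.
apply: le_mul_inf.
- by apply: P1 => // u; exact: qform_unit_ge0.
- by have [] := dominating_has_inf (sTA Tx).
move=> c [l + cl]; rewrite le_eqVlt => /predU1P[l0|l0].
  have := Dge _ L1 P1 x (c *: (e : realification (H -> H))) Tx.
  rewrite (linear_onZ Tsub)// [_ * c]mulrC; apply.
    exact: (real_subspaceZ Tsub).
  by move=> u; have := cl u; rewrite -l0 qform_realZ; lra.
pose E : realification (H -> H) := e.
pose d : realification (H -> H) := c *: E - x.
pose b : realification (H -> H) := n *: E + l^-1 *: d.
have Tnf m : Tsa (m *: E) by exact: (real_subspaceZ Tsub).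
have Td : Tsa d by exact: (real_subspaceB Tsub).
have Tb : Tsa b.
  by apply: (real_subspaceD Tsub) => //; exact: (real_subspaceZ Tsub).
have sb : op_le ip s b.
  apply/op_leP; [by case: hs|by case: Tb|] => u.
  rewrite qformD !qform_realZ qformD qformN qform_realZ.
  have H1 := cl u.
  rewrite -subr_ge0 -(pmulr_rge0 _ l0) mulrBr mulrDr mulVKf ?gt_eqF//.
  lra.
have [b' [Tb' b'S b'n sb' b'b]] := hST Ss hs.2 Tb.1 Tb.2 sb.
have Tsab' : Tsa b' by split.
move/(op_leP hs.2 b'S) : sb' => sb'; move/(op_leP b'S Tb.2) : b'b => b'b.
have b'e u : q b' u <= q (n *: E) u.
  apply: le_trans (qform_le_opnorm u (sTA Tsab')) _.
  by rewrite qform_realZ ler_wpM2r// qform_unit_ge0.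
have H2 := Dge _ L2 P2 _ _ Tsab' (Tnf n) b'e.
rewrite (linear_onZ Tsub)// in H2.
have H1 := Dge _ L1 P1 _ _ Tsab' Tb b'b.
have : n <= psi b'.
  rewrite -psis -subr_ge0 -(linear_onB Asub psiL)//; last exact: sTA.
  apply: (below_gauge_ge0 psiL psi_le).
    by apply: (real_subspaceB Asub) => //; exact: sTA.
  by move=> u; rewrite qformD qformN subr_ge0.
rewrite psiE//; have := psiE _ Tsae; rewrite psie => E1 H3.
have H4 : n * phi1 E <= phi1 b.
  apply: le_trans H1; move: H2 H3; rewrite /E.
  have -> : phi2 e = 1 - phi1 e by lra.
  by rewrite mulrBr mulr1; lra.
move: H4; rewrite (linear_onD L1)//; last exact: (real_subspaceZ Tsub).
rewrite !(linear_onZ Tsub)// lerDl pmulr_rge0 ?invr_gt0//.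
by rewrite (linear_onB Tsub)// (linear_onZ Tsub)// subr_ge0 mulrC.
Qed.

Lemma norming_extreme : exists psi, [/\ linear_on Asa psi,
  (forall x, Asa x -> psi x <= gauge x) &
  forall phi1 phi2, positive_linear phi1 -> positive_linear phi2 ->
    (forall x, Tsa x -> psi x = phi1 x + phi2 x) ->
    forall x, Tsa x -> phi1 x = phi1 e * psi x].
Proof.
apply: extreme_minorant => //.
- by move=> phi [].
- by move=> phi [_]; apply=> // u; exact: qform_unit_ge0.
- exact: gauge_sublinear.
- exact: gauge_unital.
- exact: gauge_facial.
Qed.

End NormingStates.
End UnitalAlgebra.

(** * From real to complex functionals *)

Section PureStates.
Variables (R : realType) (H : completeNormedModType R[i]).
Variables (ip : {dot H for Num.conj}).
Hypothesis hip : norm_from_ip ip.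
Variables (A : set (H -> H)) (e : H -> H).
Hypothesis hA : unital_cstar_algebra ip A e.
Local Notation Re := complex.Re.
Local Notation Im := complex.Im.
Local Notation q := (qform ip).
Local Notation Asa := (sa_part ip A).

Lemma Re_ge0 (z : R[i]) : 0 <= z -> 0 <= Re z.
Proof. by rewrite lecE => /andP[]. Qed.

Lemma op_ge0_sa_part f : A f -> op_ge0 ip f -> Asa f.
Proof.
move=> Af f0; have [Ag fg] := adjP hip (cstar_subspace hA) Af; split=> //.
by apply: (op_ge0_self_adjoint hip _ _ fg f0); [case: (cstar_bounded hA Af)
  |case: (cstar_bounded hA Ag)].
Qed.

Lemma complexify_state psi : linear_on Asa psi ->
  (forall f, Asa f -> (forall u, 0 <= q f u) -> 0 <= psi f) -> psi e = 1 ->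
  state ip e A (complexify ip psi).
Proof.
move=> psiL psi0 psie; have hAs := cstar_subspace hA; split; first split.
- exact: complexify_linear.
- move=> f Af f0; have fsa := op_ge0_sa_part Af f0.
  rewrite (complexify_sa hip hAs)// ler0c; apply: psi0 => //.
  by apply/op_ge0P; case: fsa.
- by rewrite (complexify_sa hip hAs psiL (unit_in_sa hA)) psie.
Qed.

Section OperatorSystem.
Variable T : set (H -> H).
Hypothesis hT : operator_system ip A e T.
Local Notation Tsa := (sa_part ip T).

(** [f] is the difference of the positive elements [|f| e] and [|f| e - f]. *)
Lemma positive_functional_Im phi f : positive_functional ip T phi ->
  Tsa f -> Im (phi f) = 0.
Proof.
move=> [phiL phi0] fsa; have [Tf fS] := fsa; have [TA hTs Te] := hT.
have [T0 TL] := hTs.1; have Tsub := sa_part_subspace hTs.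
have eS := unit_self_adjoint hA.
have phie : 0 <= phi e.
  by apply: phi0 => //; apply/(op_ge0P eS) => u; exact: (qform_unit_ge0 hip hA).
pose E : realification (H -> H) := e; pose n := opnorm f.
have Ene : Tsa (n *: E) by apply: (real_subspaceZ Tsub).
have [Tg gS] := real_subspaceB Tsub Ene fsa.
have : 0 <= phi (-1 *: f + (n%:C%C *: e + 0)).
  rewrite addr0 scaleN1r addrC; apply: phi0 => //; apply/(op_ge0P gS) => u.
  rewrite qformD qformN subr_ge0 qform_realZ.
  by apply: (qform_le_opnorm hip hA); split=> //; exact: TA.
have phi00 : phi 0 = 0.
  by have := phiL (-1) 0 0 T0 T0; rewrite scaler0 addr0 mulN1r addNr.
rewrite (phiL _ _ _ Tf); last by rewrite addr0; case: Ene.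
rewrite phiL// phi00 addr0 => /ger0_Im.
by rewrite raddfD /= !ImM_real (ger0_Im phie); lra.
Qed.

Lemma positive_functional_Re phi : positive_functional ip T phi ->
  positive_linear ip T (fun f => Re (phi f)).
Proof.
move=> [phiL phi0]; split.
  by move=> a f g [Tf _] [Tg _]; rewrite phiL// raddfD /= ReM_real.
by move=> f [Tf fS] f0; apply/Re_ge0/phi0 => //; apply/op_ge0P.
Qed.

(** A decomposition of the complex functional on [T] gives, by real parts, one of
    [psi] on the self-adjoint elements; the scalar found there works on [T]
    because positive functionals are real on self-adjoint elements. *)
Lemma complexify_pure psi : linear_on Asa psi ->
  (forall f, Asa f -> (forall u, 0 <= q f u) -> 0 <= psi f) -> psi e = 1 ->
  (forall phi1 phi2, positive_linear ip T phi1 -> positive_linear ip T phi2 ->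
    (forall x, Tsa x -> psi x = phi1 x + phi2 x) ->
    forall x, Tsa x -> phi1 x = phi1 e * psi x) ->
  pure_state ip e T (complexify ip psi).
Proof.
move=> psiL psi0 psie psi_ext; have [TA hTs Te] := hT.
have [[PL P0] Pe] := complexify_state psiL psi0 psie.
split.
  by split=> //; split=> [c f g Tf Tg|f Tf]; [apply: PL|apply: P0]; exact: TA.
move=> phi phiP phi'P.
have D1 := positive_functional_Re phiP; have D2 := positive_functional_Re phi'P.
have esa : Tsa e by split=> //; exact: (unit_self_adjoint hA).
have Asa_of f : Tsa f -> Asa f by case=> Tf fS; split=> //; exact: TA.
have ext := psi_ext _ _ D1 D2.
have {}ext : forall f, Tsa f -> Re (phi f) = Re (phi e) * psi f.
  apply: ext => f Tf; rewrite (complexify_sa hip (cstar_subspace hA))//; last exact: Asa_of.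
  by rewrite raddfB /=; lra.
have ge0 (u : H) : 0 <= q e u by exact: (qform_unit_ge0 hip hA).
exists (Re (phi e)).
  apply/andP; split; first exact: D1.2.
  have := D2.2 _ esa ge0; rewrite Pe raddfB /=; lra.
move=> f Tf; have rf := re_op_sa hip hTs Tf; have mf := im_op_sa hip hTs Tf.
have phiE g : Tsa g -> phi g = (Re (phi e) * psi g)%:C%C.
  move=> Tg; rewrite -ext//; have := positive_functional_Im phiP Tg.
  by case: (phi g) => a b /= ->.
have -> : phi f = 'i%C * phi (im_op ip f) + phi (re_op ip f).
  by rewrite -phiP.1 ?(addrC ('i%C *: _)) -?re_im_opK//; [case: mf|case: rf].
rewrite (phiE _ mf) (phiE _ rf) /complexify; move: (Re (phi e)) => t.
by apply/eqP; rewrite eq_complex /=; apply/andP; split; apply/eqP; ring.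
Qed.

End OperatorSystem.
End PureStates.

(** * Norming states that are pure on the operator system *)

Section NormingPureStates.
Variables (R : realType) (H : completeNormedModType R[i]).
Variables (ip : {dot H for Num.conj}).
Hypothesis hip : norm_from_ip ip.
Variables (A : set (H -> H)) (e : H -> H).
Hypothesis hA : unital_cstar_algebra ip A e.
Variables (S T : set (H -> H)).
Hypotheses (hSA : S `<=` A) (hS : self_adjoint_subspace ip S).
Hypotheses (hT : operator_system ip A e T) (hST : unperforated ip S T).

Lemma norming_pure_state_of_attains_norm s : S s -> self_adjoint ip s -> attains_norm ip e s ->
  exists psi, [/\ state ip e A psi, pure_state ip e T psi &
    psi s = (opnorm s)%:C%C].
Proof.
move=> Ss sS s_att; have hs : sa_part ip A s by split=> //; exact: hSA.
have [psi [psiL psi_le psi_ext]] := norming_extreme hip hA hT hST Ss hs s_att.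
have psi0 := below_gauge_ge0 hip hA s_att psiL psi_le.
have psie := below_gauge_unit hip hA hT s_att psiL psi_le.
exists (complexify ip psi); split.
- exact: (complexify_state hip hA).
- exact: (complexify_pure hip hA).
- rewrite (complexify_sa hip (cstar_subspace hA))//.
  by rewrite (below_gauge_norming hip hA hs s_att psiL psi_le).
Qed.

Lemma norming_pure_state s : S s -> self_adjoint ip s ->
  exists psi, [/\ state ip e A psi, pure_state ip e T psi &
    complex.Re `|psi s| = opnorm s].
Proof.
move=> Ss sS; have As := hSA Ss; have hs : sa_part ip A s by [].
have n0 : 0 <= opnorm s by apply: opnorm_ge0; exact: cstar_bounded hA _ As.
have [att|att] := attains_norm_or hip hA hs.
  have [psi [psiA psiT psis]] := norming_pure_state_of_attains_norm Ss sS att.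
  by exists psi; split=> //; rewrite psis ger0_norm ?ler0c.
have [SNs NsS] := real_subspaceN (sa_part_subspace hS) (conj Ss sS).
have [psi [psiA psiT psis]] := norming_pure_state_of_attains_norm SNs NsS att.
exists psi; split=> //; rewrite opnormN in psis.
have psiN : psi (- s) = - psi s.
  have [[psiL _] _] := psiA; have A0 := (cstar_subspace hA).1.1.
  have psi00 : psi 0 = 0.
    have := psiL (-1) 0 0 A0 A0; rewrite scaler0 addr0 mulN1r addNr; exact.
  by have := psiL (-1) s 0 As A0; rewrite addr0 scaleN1r psi00 addr0 mulN1r.
by rewrite -normrN -psiN psis ger0_norm ?ler0c.
Qed.

End NormingPureStates.

Theorem theorem5p2 (R : realType) (H : completeNormedModType R[i])
    (ip : {dot H for Num.conj}) (hip : norm_from_ip ip)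
    (A : set (H -> H)) (e : H -> H) (hA : unital_cstar_algebra ip A e)
    (S : set (H -> H)) (hSA : S `<=` A) (hS : self_adjoint_subspace ip S)
    (T : set (H -> H)) (hT : operator_system ip A e T)
    (hTsep : norm_separable T)
    (hST : unperforated ip S T) :
  (forall s : H -> H, S s -> self_adjoint ip s ->
     exists psi : (H -> H) -> R[i],
       [/\ state ip e A psi, pure_state ip e T psi &
           complex.Re `|psi s| = opnorm s]) /\
  (exists F : set ((H -> H) -> R[i]),
     (forall psi, F psi -> state ip e A psi /\ pure_state ip e T psi) /\
     separates ip F S).
Proof.
have norming := norming_pure_state hip hA hSA hS hT hST.
split=> //; exists [set psi | state ip e A psi /\ pure_state ip e T psi].
split=> // s Ss sS s0; have [psi [psiA psiT psis]] := norming s Ss sS.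
have sB := cstar_bounded hA (hSA _ Ss).
have n0 : 0 < opnorm s.
  rewrite lt_neqAle opnorm_ge0// andbT; apply/eqP => n0; apply: s0.
  apply/funext => x; apply/eqP; rewrite -normr_eq0 rnormE.
  have := rnorm_opnorm x sB; rewrite -n0 mul0r => sx.
  by rewrite (@le_anti _ _ (rnorm (s x)) 0)// sx rnorm_ge0.
apply: (@lt_le_trans _ _ (opnorm s)%:E); first by rewrite lte_fin.
by apply: ereal_sup_ubound; exists psi => //; rewrite psis.
Qed.
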